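(* Let $q$ and $n$ be positive integers, let $C \subseteq \mathbb{Z}_q^n$ be a $q$-ary linear code and let $\Lambda_q(C)\subseteq\mathbb{Z}^n$ be the associated $q$-ary lattice. Let $r=(r_1,\ldots,r_n)^t\in\mathbb{R}^n$ and let $x=(x_1,\ldots,x_n)^t\in\Lambda_q(C)$, with class $\overline{x}\in\Lambda_q(C)/q\mathbb{Z}^n$. Define $z=(z_1,\ldots,z_n)^t$ by $$z_i = x_i + q w_i,\qquad w_i=\left\lceil \frac{r_i-x_i}{q}\right\rfloor,\qquad i=1,\ldots,n.$$ Then $z\in\Lambda_q(C)$ is a representative of $\overline{x}$ (that is, $z\in x+q\mathbb{Z}^n$), and among all representatives of $\overline{x}$ it is closest to $r$ in the Lee metric: $$d(r,z)=\min\{d(r,y) : y\in x+q\mathbb{Z}^n\}.$$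
   Context: A $q$-ary linear code is a $\mathbb{Z}_q$-submodule $C$ of $\mathbb{Z}_q^n$, where $\mathbb{Z}_q=\mathbb{Z}/q\mathbb{Z}$. Let $\phi:\mathbb{Z}^n\to\mathbb{Z}_q^n$ be coordinatewise reduction modulo $q$. The $q$-ary lattice associated to $C$ (Construction A) is $\Lambda_q(C)=\phi^{-1}(C)$; it contains $q\mathbb{Z}^n$, and $\Lambda_q(C)/q\mathbb{Z}^n$ is identified with $C$. On $\mathbb{R}^n$ the Lee distance means the $l_1$ distance $d(x,y)=\sum_{i=1}^n|x_i-y_i|$. The symbol $\lceil a\rfloor$ denotes an integer nearest to the real number $a$ (ties may be broken either way). *)

(* Defs.v *)
From HB Require Import structures.
From mathcomp Require Import all_boot all_order all_algebra.
From mathcomp Require Import all_classical all_reals.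

Set Implicit Arguments.
Unset Strict Implicit.
Unset Printing Implicit Defensive.

Import Order.TTheory GRing.Theory Num.Theory.
Local Open Scope classical_set_scope.
Local Open Scope ring_scope.

(* MathComp's 'Z_q is Z/2Z when q = 1.  [Zmod q] is Z/qZ for every q > 0,
   including the trivial ring for q = 1 (for q = 0 it is a junk value). *)
Definition Zmod (q : nat) : Type := 'I_q.-1.+1.

HB.instance Definition _ (q : nat) := FinRing.Zmodule.on (Zmod q).
HB.instance Definition _ (q : nat) :=
  GRing.Zmodule_isComPzRing.Build (Zmod q)
    (@Zp_mulA q.-1.+1) (@Zp_mulC q.-1.+1) (@Zp_mul1z q.-1) (@Zp_mul_addl q.-1.+1).

Definition linear_code (q n : nat) (C : {set 'cV[Zmod q]_n}) : Prop :=
  GRing.submod_closed C.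

(* [intr] is the unique ring morphism from int to Z/qZ; see [val_intr_Zmod]. *)
Definition reduction (q n : nat) (x : 'cV[int]_n) : 'cV[Zmod q]_n :=
  map_mx intr x.

Lemma val_intr_Zmod (q : nat) (m : int) : (0 < q)%N ->
  Posz (nat_of_ord (m%:~R : Zmod q)) = (m %% q%:Z)%Z.
Proof.
case: q => // q _.
have natE k : (k%:R : Zmod q.+1) = inZp k.
  elim: k => [|k IHk]; first by apply: val_inj; rewrite /= mod0n.
  by rewrite mulrSr IHk; apply: val_inj; rewrite /= modnDm addn1.
case: m => k; first by rewrite -pmulrn natE modz_nat.
rewrite NegzE mulrNz -pmulrn natE [nat_of_ord _]/=.
rewrite -(modz_nat (_ - _)) -subzn; last by rewrite ltnW // ltn_mod.
by rewrite modzDl -modz_nat modzNm.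
Qed.

Definition qary_lattice (q n : nat) (C : {set 'cV[Zmod q]_n}) :
    set 'cV[int]_n :=
  [set x | reduction q x \in C].

(* The class of x modulo q Z^n, i.e. the set of its representatives. *)
Definition qcoset (q n : nat) (x : 'cV[int]_n) : set 'cV[int]_n :=
  [set y | exists v : 'cV[int]_n, y = x + q%:Z *: v].

Definition real_vec (R : realType) (n : nat) (x : 'cV[int]_n) : 'cV[R]_n :=
  map_mx intr x.

Definition lee_dist (R : realType) (n : nat) (x y : 'cV[R]_n) : R :=
  \sum_(i < n) `|x i 0 - y i 0|.

(* When a is a half-integer, both neighbours qualify. *)
Definition nearest_int (R : realType) (a : R) (m : int) : Prop :=
  forall k : int, `|a - m%:~R| <= `|a - k%:~R|.

Definition is_min (R : realType) (A : set R) (m : R) : Prop :=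
  A m /\ lbound A m.

(* Main.v *)
Require Import Defs.
From HB Require Import structures.
From mathcomp Require Import all_boot all_order all_algebra.
From mathcomp Require Import all_classical all_reals.

Import Order.TTheory GRing.Theory Num.Theory.
Local Open Scope classical_set_scope.
Local Open Scope ring_scope.

(** The coordinates of a representative [x + q v] vary independently and the Lee distance is a sum
    over coordinates, so each term can be minimised separately. The term [|r_i - x_i - q v_i|] is
    [q] times the distance from [(r_i - x_i) / q] to [v_i], hence least at a nearest integer
    ([nearest_int_scale]). Membership in the lattice depends only on the class modulo [q]
    ([reduction_qcoset]). *)

Lemma intr_Zmod_char (q : nat) (q_gt0 : (0 < q)%N) :
  (q%:Z)%:~R = 0 :> Zmod q.
Proof.
(* Injectivity of [Posz] moves the equation to integers, where it reads [q mod q = 0]. *)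
apply: val_inj; apply: (can_inj absz_nat).
by rewrite val_intr_Zmod // modzz.
Qed.

Lemma reduction_qcoset (q n : nat) (q_gt0 : (0 < q)%N) (x y : 'cV[int]_n) :
  qcoset q x y -> reduction q y = reduction q x.
Proof.
case=> v ->; apply/matrixP => i j.
by rewrite !mxE rmorphD rmorphM /= intr_Zmod_char // mul0r addr0.
Qed.

(** Factoring out [c > 0] turns both sides into [c] times a distance from [a / c] to an integer. *)
Lemma nearest_int_scale (R : realType) (c a : R) (c_gt0 : 0 < c) (m k : int) :
  nearest_int (a / c) m -> `|a - c * m%:~R| <= `|a - c * k%:~R|.
Proof.
have scale (j : int) : `|a - c * j%:~R| = c * `|a / c - j%:~R|.
  rewrite -[X in X * `|_|](gtr0_norm c_gt0) -normrM mulrBr mulrCA divff ?mulr1 //.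
  by rewrite lt0r_neq0.
by move=> m_nearest; rewrite !scale ler_pM2l.
Qed.

Theorem proposition1 (R : realType) (q n : nat) (q_gt0 : (0 < q)%N)
    (n_gt0 : (0 < n)%N)
    (C : {set 'cV[Zmod q]_n}) (C_linear : linear_code C)
    (r : 'cV[R]_n) (x : 'cV[int]_n) (x_in : qary_lattice C x)
    (w : 'cV[int]_n)
    (w_nearest : forall i : 'I_n,
      nearest_int ((r i 0 - (x i 0)%:~R) / q%:R) (w i 0))
    (z : 'cV[int]_n)
    (z_def : forall i : 'I_n, z i 0 = x i 0 + q%:Z * w i 0) :
  [/\ qary_lattice C z,
      qcoset q x z &
      is_min [set lee_dist r (real_vec R y) | y in qcoset q x]
             (lee_dist r (real_vec R z))].
Proof.
have z_rep : qcoset q x z.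
  by exists w; apply/matrixP => i j; rewrite ord1 !mxE z_def.
split=> //; first by rewrite /qary_lattice /= (reduction_qcoset _ _ q_gt0 _ _ z_rep).
split; first by exists z.
(* No coordinate of [z] is farther from [r] than that of any competitor [x + q v]. *)
move=> _ [y [v ->] <-]; apply: ler_sum => i _.
(* Regrouping exposes [a = r_i - x_i] and [c = q]. *)
rewrite !mxE z_def !rmorphD !rmorphM /= !opprD !addrA.
by apply: nearest_int_scale; rewrite ?ltr0n.
Qed.
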